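(* Let $E$ be a real Banach space of dimension at least $2$ and let $G\subsetneq E$ be a domain. Then the following implications hold. (i) If $G$ is $c$-uniform for some $c\ge 1$, then $G$ has the min-max property. (ii) If $G$ has the min-max property, then $G$ is diameter $c_1$-uniform for some $c_1\ge 1$. (iii) $G$ is diameter $c_1$-uniform for some $c_1\ge 1$ if and only if $G$ is $\delta$-uniform for some $0<\delta<1$.
   Context: A domain is a nonempty connected open set; the norm of $E$ is written $|\cdot|$; $\partial G$ is the norm boundary and $d_G(x)=\operatorname{dist}(x,\partial G)$ for $x\in G$. For a curve or arc $\gamma$ and $x,z\in\gamma$, $\gamma[x,z]$ is the part of $\gamma$ between $x$ and $z$, and $\ell(\gamma)$ is the norm length of $\gamma$. $c$-uniform ($c\ge1$): each pair of points $x,y\in G$ can be connected by an arc $\gamma$ in $G$ with $\ell(\gamma)\le c|x-y|$ and $\min\{\ell(\gamma[x,z]),\ell(\gamma[z,y])\}\le c\,d_G(z)$ for all $z\in\gamma$. Diameter $c$-uniform ($c\ge1$): each pair of points $x_1,x_2\in G$ can be joined by an arc $\alpha$ in $G$ with $\operatorname{diam}\alpha\le c|x_1-x_2|$ and $\min_{j=1,2}\operatorname{diam}(\alpha[x_j,x])\le c\,d_G(x)$ for all $x\in\alpha$. Min-max property: there exist a family $\Gamma$ of curves in $G$ and a constant $c\ge1$ such that any pair of points in $G$ can be joined by a curve $\gamma\in\Gamma$ and so that $$\frac1c\min_{j=1,2}|x_j-y|\le |x-y|\le c\max_{j=1,2}|x_j-y|$$ for each ordered triple of points $x_1,x,x_2\in\gamma$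 (i.e. $x$ lies between $x_1$ and $x_2$ along $\gamma$) and each $y\in\partial G$. $\delta$-uniform ($0<\delta<1$): each pair of (distinct) points $x_1,x_2\in G$ can be joined by an arc $\alpha$ in $G$ such that $$\frac{|x-y|}{|x-x_i|}\cdot\frac{|x_i-x_j|}{|x_j-y|}\ge\delta,\qquad i\ne j\in\{1,2\},$$ for all $x\in\alpha\setminus\{x_1,x_2\}$ and all $y\in E\setminus G$. *)

(* Defs.v *)
From mathcomp Require Import all_boot all_order all_algebra.
From mathcomp Require Import all_classical all_reals all_analysis.
Import Order.TTheory GRing.Theory Num.Theory.
Import numFieldNormedType.Exports.

Set Implicit Arguments.
Unset Strict Implicit.
Unset Printing Implicit Defensive.

Local Open Scope classical_set_scope.
Local Open Scope ring_scope.

Definition dim_ge2 (R : realType) (E : normedModType R) : Prop :=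
  exists u v : E, forall a b : R, a *: u + b *: v = 0 -> a = 0 /\ b = 0.

Definition is_domain (T : topologicalType) (G : set T) : Prop :=
  [/\ G !=set0, open G & connected G].

Definition boundary (T : topologicalType) (A : set T) : set T :=
  closure A `\` interior A.

Definition boundary_dist (R : realType) (E : normedModType R)
    (G : set E) (x : E) : \bar R :=
  edist_inf (boundary G) x.

Definition diam (R : realType) (E : normedModType R) (A : set E) : \bar R :=
  ereal_sup [set `|x - y|%:E | x in A & y in A].

(* Curves are parametrized by [0, 1]; the values of g outside [0, 1] are
   irrelevant. The point g t lies between g s and g u along the curve when
   s <= t <= u. *)
Definition curve_in (R : realType) (E : normedModType R)
    (G : set E) (g : R -> E) : Prop :=
  {within `[0, 1], continuous g} /\ g @` `[0, 1] `<=` G.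

Definition arc_in (R : realType) (E : normedModType R)
    (G : set E) (g : R -> E) : Prop :=
  curve_in G g /\ {in `[0, 1] &, injective g}.

Definition joins (R : realType) (E : normedModType R)
    (g : R -> E) (x y : E) : Prop :=
  g 0 = x /\ g 1 = y.

(* The vector-valued analogue of variation and total_variation, which the
   library defines for real-valued functions only. *)
Definition polygon_length (R : realType) (E : normedModType R)
    (a b : R) (g : R -> E) (s : seq R) : R :=
  let p := g \o nth b (a :: s) in
  \sum_(0 <= n < size s) `|p n.+1 - p n|.

Definition curve_length (R : realType) (E : normedModType R)
    (a b : R) (g : R -> E) : \bar R :=
  ereal_sup [set (polygon_length a b g s)%:E | s in itv_partition a b].

(* In this definition and the next ones, pairs of coinciding points are left
   out: such a pair is joined by the degenerate arc reduced to that point,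
   for which the required inequalities are trivial, but this arc has no
   injective parametrization by [0, 1]. *)
Definition uniform_domain (R : realType) (E : normedModType R)
    (c : R) (G : set E) : Prop :=
  forall x y : E, G x -> G y -> x != y ->
  exists g : R -> E,
    [/\ arc_in G g, joins g x y,
        ((curve_length 0 1 g)%R <= (c * `|x - y|)%:E)%E
      & forall t : R, t \in `[0, 1] ->
          (Order.min (curve_length 0 t g)%R (curve_length t 1 g)%R
             <= c%:E * boundary_dist G (g t))%E].

Definition diam_uniform_domain (R : realType) (E : normedModType R)
    (c : R) (G : set E) : Prop :=
  forall x1 x2 : E, G x1 -> G x2 -> x1 != x2 ->
  exists g : R -> E,
    [/\ arc_in G g, joins g x1 x2,
        ((diam (g @` `[0, 1]))%R <= (c * `|x1 - x2|)%:E)%E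
      & forall t : R, t \in `[0, 1] ->
          (Order.min (diam (g @` `[0, t]))%R (diam (g @` `[t, 1]))%R
             <= c%:E * boundary_dist G (g t))%E].

Definition delta_uniform_domain (R : realType) (E : normedModType R)
    (delta : R) (G : set E) : Prop :=
  forall x1 x2 : E, G x1 -> G x2 -> x1 != x2 ->
  exists g : R -> E,
    [/\ arc_in G g, joins g x1 x2
      & forall x y : E, (g @` `[0, 1]) x -> x != x1 -> x != x2 -> ~ G y ->
          delta <= (`|x - y| / `|x - x1|) * (`|x1 - x2| / `|x2 - y|) /\
          delta <= (`|x - y| / `|x - x2|) * (`|x2 - x1| / `|x1 - y|)].

Definition min_max_property (R : realType) (E : normedModType R)
    (G : set E) : Prop :=
  exists (Gamma : set (R -> E)) (c : R),
    [/\ 1 <= c,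
        forall g, Gamma g -> curve_in G g,
        forall x y : E, G x -> G y -> exists2 g, Gamma g & joins g x y
      & forall g, Gamma g -> forall s t u : R,
          0 <= s -> s <= t -> t <= u -> u <= 1 ->
          forall y : E, boundary G y ->
            c^-1 * Num.min `|g s - y| `|g u - y| <= `|g t - y| /\
            `|g t - y| <= c * Num.max `|g s - y| `|g u - y|].

(* Main.v *)
Require Import Defs.
From mathcomp Require Import all_boot all_order all_algebra.
From mathcomp Require Import all_classical all_reals all_analysis.
From mathcomp Require Import ring lra zify.
Import Order.TTheory GRing.Theory Num.Theory.
Import numFieldNormedType.Exports.
Local Open Scope classical_set_scope.
Local Open Scope ring_scope.
Set Implicit Arguments.
Unset Strict Implicit.
Unset Printing Implicit Defensive.

(** All four notions are compared with one intermediate property, [cigar_arc]: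
    an arc from x1 to x2 stays within C|x1 - x2| of x1 and, at each of its
    points z, either the part before z lies within C d(z) of x1 or the part
    after z lies within C d(z) of x2, where d is the distance to the
    complement.  Up to constants this is diameter uniformity.

    A uniform arc is a cigar arc because chords are no longer than the arc.
    A cigar arc satisfies the min-max inequalities at every ordered triple: if
    both outer points lie within rho of a boundary point then d is at most rho
    at each of them, so either the whole triple lies near one endpoint, or
    each outer point lies near its own endpoint and then the endpoints, hence
    the entire arc, are within a multiple of rho ([cigar_min_max]).
    Conversely, let x be a point of a min-max curve and y a boundary point at
    distance comparable to d(x).  By the first inequality there cannot be a
    point before x and a point after x which are both much farther from y than
    x is; so one of the two parts lies in a ball of radius comparable to d(x)
    ([min_max_cigar]).  This gives a curve, not an arc.

    Arcs are recovered through finite chains of points whose steps are small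
    compared with d ([gchain]): a polygon contains an arc which follows the
    order of the polygon ([polygon_arc]), and cigar estimates survive because
    they only refer to the order ([chain_cigar_arc]).  Concatenating,
    truncating and reversing chains is elementary, so all constructions are
    done with chains.

    A cigar arc is delta-uniform by the triangle inequality
    ([cigar_delta_uniform]).  The converse is the long part.  The cross-ratio
    condition controls a delta-uniform arc only through the distances to its
    two endpoints, min |z - x_j| <= C d(z) ([delta_distance_cigar]); the arc
    may go away from x1, return near x1 and only then go to x2.  It is
    therefore replaced.  From x1 one climbs: an initial piece of an arc towards
    a remote point leads to a point where d has doubled, within a distance
    comparable to d; iterating until d is comparable to |x1 - x2| gives a
    chain whose diameter at each stage is a geometric sum dominated by the
    current d ([climb]).  The same is done from x2, and it remains to link two
    points z1, z2 with large d inside a ball of comparable radius.  If some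
    point of the complement is remote, the cross-ratio condition at that point
    bounds the delta-uniform arc from z1 to z2 ([delta_link_near]).  Otherwise
    the complement lies in a ball; one climbs out of it on both sides and goes
    around it, which is where the dimension is used ([annulus_linked]). *)

(** * Distance to the complement *)

Lemma closed_itv_min (R : realType) (a b : R) (A : set R) :
  closed A -> (exists2 t, a <= t <= b & A t) ->
  exists s, [/\ a <= s <= b, A s & forall t, a <= t <= b -> A t -> s <= t].
Proof.
move=> cA [t0 t0ab At0].
have cpt : compact (`[a, b] `&` A).
  by apply: (@subclosed_compact _ _ `[a, b]);
    [apply: closedI => //; exact: itv_closed|exact: segment_compact|exact: subIsetl].
have ne : `[a, b] `&` A !=set0 by exists t0; split.
have idc : {within `[a, b] `&` A, continuous (@idfun R)}.
  by apply: continuous_subspaceT => x; exact: cvg_id.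
have [s /set_mem[/= sab As] smin] := compact_EVT_min ne cpt idc.
exists s; split => // t tab At; apply: smin; rewrite inE; split => //=.
Qed.

Section ComplementDistance.
Variables (R : realType) (E : normedModType R) (G : set E).
Implicit Types x y z : E.

(** Measured to the complement and not to the boundary, so that the values
    are real, the function is 1-Lipschitz on the whole space, and being
    positive means being in [G]; on [G] both distances agree
    ([boundary_distE]). *)
Definition cdist x : R := inf [set `|x - y| | y in ~` G].

Lemma cdist_le x y : ~ G y -> cdist x <= `|x - y|.
Proof.
move=> Gy; apply: ge_inf; last by exists y.
by exists 0 => _ [z _ <-].
Qed.

Hypothesis GT : G <> setT.

Lemma compl_nonempty : exists y, ~ G y.
Proof.
apply: contrapT => /forallNP h; apply: GT; apply/seteqP; split=> // x _.
exact: contrapT (h x).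
Qed.

Lemma le_cdist x r : (forall y, ~ G y -> r <= `|x - y|) -> r <= cdist x.
Proof.
move=> h; apply: lb_le_inf => [|_ [y Gy <-]]; last exact: h.
by have [y Gy] := compl_nonempty; exists `|x - y|, y.
Qed.

Lemma cdist_lip x y : cdist x <= cdist y + `|x - y|.
Proof.
rewrite -lerBlDr; apply: le_cdist => z Gz; rewrite lerBlDl.
by apply: le_trans (cdist_le x Gz) _; exact: ler_distD.
Qed.

Lemma cdist_ge0 x : 0 <= cdist x.
Proof. exact: le_cdist. Qed.

Lemma cdist_adherent x r : cdist x < r -> exists2 y, ~ G y & `|x - y| < r.
Proof.
move=> xr; apply: contrapT => h; move: xr; apply/negP; rewrite -leNgt.
apply: le_cdist => y Gy; rewrite leNgt; apply/negP => yr; apply: h.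
by exists y.
Qed.

Lemma cdist_gt0_in x : 0 < cdist x -> G x.
Proof.
move=> h; apply: contrapT => /(cdist_le x).
by rewrite subrr normr0 leNgt h.
Qed.

Hypothesis oG : open G.

Lemma cdist_gt0 x : G x -> 0 < cdist x.
Proof.
move=> Gx; have := @open_nbhs_nbhs _ x G (conj oG Gx).
rewrite -nbhs_ballE => -[e /= e0 xeG].
apply: (lt_le_trans e0); apply: le_cdist => y Gy; rewrite leNgt.
by apply/negP => ye; apply: Gy; apply: xeG; rewrite -ball_normE.
Qed.

(** The first point of the segment from [x] to [y] which is outside [G]. *)
Lemma boundary_on_segment x y : G x -> ~ G y ->
  exists2 b, boundary G b & `|x - b| <= `|x - y|.
Proof.
move=> Gx Gy; pose f (t : R) : E := x + t *: (y - x).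
have cf : continuous f.
  by move=> t; apply: cvgD; [exact: cvg_cst|apply: cvgZr_tmp; exact: cvg_id].
have cA : closed (f @^-1` (~` G)).
  by apply: closed_comp; [move=> t _; exact: cf|exact: open_closedC].
have [|s [/andP[s0 s1] Gs smin]] := @closed_itv_min _ 0 1 _ cA.
  by exists 1; rewrite ?ler01 ?lexx //= /f scale1r addrC subrK.
have s_gt0 : 0 < s.
  rewrite lt_neqAle s0 andbT; apply/eqP => s00; apply: Gs.
  by rewrite -s00 /f scale0r addr0.
exists (f s); last first.
  by rewrite /f opprD addNKr normrN normrZ ger0_norm // distrC ler_piMl.
split; last by move=> /interior_subset.
move=> U; have := cf s; rewrite /continuous_at => /(_ U) /[apply].
rewrite /= -nbhs_ballE => -[e /= e0 seU].
pose t := Num.max 0 (s - e / 2).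
have ts : t < s by rewrite gt_max s_gt0 /=; lra.
have t0 : 0 <= t by rewrite le_max lexx.
have te : s - e / 2 <= t by rewrite le_max lexx orbT.
exists (f t); split.
  apply: contrapT => Gt.
  have t1 : 0 <= t <= 1 by rewrite t0 /=; lra.
  by have := smin t t1 Gt; rewrite leNgt ts.
by apply: seU; rewrite /ball /= ger0_norm; lra.
Qed.

Lemma edist_norm x y : edist (x, y) = `|x - y|%:E.
Proof.
apply/eqP; rewrite eq_le; apply/andP; split.
  apply/lee_addgt0Pr => e e0; rewrite -EFinD; apply: edist_fin => /=.
    exact: ltr_wpDl.
  by rewrite -ball_normE /= ltrDl.
apply: le_ereal_inf_tmp => _ [r [/= r0 xyr] <-]; rewrite lee_fin.
by apply: ltW; move: xyr; rewrite -ball_normE.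
Qed.

Lemma boundary_distE x : G x -> boundary_dist G x = (cdist x)%:E.
Proof.
move=> Gx; apply/eqP; rewrite eq_le; apply/andP; split; last first.
  apply: le_ereal_inf_tmp => _ [y [_ Gy] <-]; rewrite edist_norm lee_fin.
  by apply: cdist_le; move: Gy; rewrite (interior_id _).1.
apply/lee_addgt0Pr => e e0.
have [|y Gy xy] := @cdist_adherent x (cdist x + e); first by rewrite ltrDl.
have [b Gb xb] := boundary_on_segment Gx Gy.
apply: (@le_trans _ _ (edist (x, b))); first by apply: ereal_inf_lbound; exists b.
by rewrite edist_norm -EFinD lee_fin (le_trans xb) // ltW.
Qed.

Lemma boundary_near x : G x ->
  exists2 y, boundary G y & `|x - y| <= 2 * cdist x.
Proof.
move=> Gx; have d0 := cdist_gt0 Gx.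
have [|y Gy xy] := @cdist_adherent x (2 * cdist x); first by lra.
have [b Gb xb] := boundary_on_segment Gx Gy.
by exists b => //; apply: le_trans xb (ltW xy).
Qed.

Lemma boundary_notin x : boundary G x -> ~ G x.
Proof. by case=> _; rewrite (interior_id _).1. Qed.

End ComplementDistance.

Lemma diam_leP (R : realType) (E : normedModType R) (A : set E) (r : R) :
  (diam A <= r%:E)%E <-> forall x y, A x -> A y -> `|x - y| <= r.
Proof.
split=> [h x y Ax Ay|h].
  rewrite -lee_fin; apply: le_trans h; apply: ereal_sup_ubound.
  by exists x => //; exists y.
by apply: ge_ereal_sup => _ [x Ax [y Ay <-]]; rewrite lee_fin; exact: h.
Qed.

(** * An arc inside a polygon *)

Section PolygonArc.
Variables (R : realType) (E : normedModType R).
Implicit Types x y : E.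

Definition segm x y : set E := (fun a : R => x + a *: (y - x)) @` `[0, 1].

Lemma segm_closed x y : closed (segm x y).
Proof.
apply: compact_closed; first exact: norm_hausdorff.
apply: continuous_compact; last exact: segment_compact.
apply: continuous_subspaceT => a.
by apply: cvgD; [exact: cvg_cst|apply: cvgZr_tmp; exact: cvg_id].
Qed.

Lemma segm_left x y : segm x y x.
Proof. by exists 0; rewrite ?scale0r ?addr0 //= in_itv /= ler01 lexx. Qed.

Lemma segm_dist x y z : segm x y z -> `|z - x| <= `|y - x|.
Proof.
case=> a /=; rewrite in_itv /= => /andP[a0 a1] <-.
by rewrite addrC addKr normrZ ger0_norm // ler_piMl.
Qed.

Lemma segm_tail x y z (b : R) : segm x y z -> 0 <= b <= 1 ->
  segm x y (z + b *: (y - z)).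
Proof.
case=> a /=; rewrite in_itv /= => /andP[a0 a1] <- /andP[b0 b1].
exists (a + b * (1 - a)); first by rewrite /= in_itv /=; nra.
rewrite scalerDl -addrA; congr (_ + (_ + _)).
by rewrite -scalerA; congr (_ *: _); rewrite scalerBl scale1r opprD addrA.
Qed.

(** A polygon contains an arc with the same endpoints that runs through it in
    order: [tau] records which edge a point of the arc comes from, and [rho]
    bounds the lengths of the edges.  Loops are erased edge by edge.  Given an
    arc to [p n], one stops it where it first meets the edge from [p n] to
    [p n.+1] and continues straight to [p n.+1]; by the choice of that point
    the new part meets the old one nowhere else.  The case [L = 0]
    is allowed because the polygon may return to its starting point. *)
Lemma polygon_arc (p : nat -> E) (rho : nat -> R) n :
    (forall k, (k < n)%N -> `|p k.+1 - p k| <= rho k) ->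
    (forall k, 0 <= rho k) ->
  exists (L : R) (h : R -> E) (tau : R -> nat),
  [/\ 0 <= L, continuous h,
      (forall s t, 0 <= s <= L -> 0 <= t <= L -> h s = h t -> s = t),
      h 0 = p 0%N /\ h L = p n &
      [/\ forall s t, 0 <= s -> s <= t -> t <= L -> (tau s <= tau t)%N,
          forall s, (tau s <= n)%N &
          forall s, 0 <= s <= L -> `|h s - p (tau s)| <= rho (tau s)]].
Proof.
move=> prho rho0; elim: n prho => [|n IHn] prho.
  exists 0, (fun=> p 0%N), (fun=> 0%N); split => //.
  - by move=> s; exact: cvg_cst.
  - by move=> s t; rewrite -!eq_le => /eqP<- /eqP<-.
  - by split=> // s _; rewrite subrr normr0.
have [k kn|L [h [tau [L0 hc hinj [h0 hL] [tauM tauN taurho]]]]] := IHn.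
  by apply: prho; exact: ltnW.
pose q := p n.+1; pose S := segm (p n) q.
have cA : closed (h @^-1` S).
  by apply: closed_comp; [move=> t _; exact: hc|exact: segm_closed].
have [|s0 [/andP[s00 s0L] Ss0 s0min]] := @closed_itv_min _ 0 L _ cA.
  by exists L; rewrite ?lexx ?L0 // /S /= hL; exact: segm_left.
pose m := `|q - h s0|.
have m_ge0 : 0 <= m by exact: normr_ge0.
(* Written with min and max, the concatenation is continuous on the whole line
   without any gluing; beyond the end point it runs on along a line. *)
pose h' s := h (Num.min s s0) + (Num.max (s - s0) 0 / m) *: (q - h s0).
have h'l s : s <= s0 -> h' s = h s.
  by move=> ss0; rewrite /h' min_l // max_r ?subr_le0 // mul0r scale0r addr0.
have h'r s : s0 <= s -> h' s = h s0 + ((s - s0) / m) *: (q - h s0).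
  by move=> ss0; rewrite /h' min_r // max_l ?subr_ge0.
have Sh' s : s0 <= s -> s <= s0 + m -> S (h' s).
  move=> s0s sm; rewrite h'r //; apply: segm_tail => //.
  (* If the arc first meets the edge at [q], nothing is added. *)
  have [m0|m0] := eqVneq m 0; first by rewrite m0 invr0 mulr0 lexx ler01.
  have mp : 0 < m by rewrite lt_neqAle eq_sym m0.
  by rewrite divr_ge0 ?subr_ge0 //= ler_pdivrMr // mul1r; lra.
exists (s0 + m), h', (fun s => if s <= s0 then tau s else n); split.
- lra.
- move=> s; apply: cvgD.
    apply: (@continuous_comp _ _ _ (fun s => Num.min s s0) h); last exact: hc.
    by apply: continuous_min; [exact: cvg_id|exact: cvg_cst].
  apply: cvgZr_tmp; apply: cvgM; last exact: cvg_cst.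
  apply: (@continuous_max R R (fun s => s - s0) (fun=> 0)); last exact: cvg_cst.
  by apply: cvgB; [exact: cvg_id|exact: cvg_cst].
- have mixed s t : 0 <= s <= s0 -> s0 < t <= s0 + m -> h' s <> h' t.
    move=> /andP[sge0 ss0] /andP[s0t tm] hst.
    have Shs : S (h s) by rewrite -h'l // hst; apply: Sh' => //; exact: ltW.
    have es : s = s0.
      by apply/eqP; rewrite eq_le ss0 /= s0min // sge0 /= (le_trans ss0).
    have mp : 0 < m by lra.
    move: hst; rewrite es h'l // h'r ?ltW // -{1}[h s0]addr0 => /addrI/esym/eqP.
    rewrite scaler_eq0 mulf_eq0 invr_eq0 gt_eqF ?subr_gt0 //= gt_eqF //=.
    by rewrite -normr_eq0 gt_eqF.
  move=> s t /andP[sge0 sm] /andP[tge0 tm] hst.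
  have [ss0|s0s] := leP s s0; have [ts0|s0t] := leP t s0.
  + move: hst; rewrite !h'l // => /hinj; apply.
      by rewrite sge0 (le_trans ss0).
    by rewrite tge0 (le_trans ts0).
  + by case: (@mixed s t) => //; rewrite ?sge0 ?ss0 ?s0t ?tm.
  + by case: (@mixed t s) => //; rewrite ?tge0 ?ts0 ?s0s ?sm.
  + have mp : 0 < m by lra.
    move: hst; rewrite !h'r ?ltW // => /addrI/eqP.
    have qF : (q - h s0 == 0) = false by rewrite -normr_eq0 gt_eqF.
    rewrite -subr_eq0 -scalerBl scaler_eq0 qF orbF.
    by rewrite -mulrBl mulf_eq0 invr_eq0 (gt_eqF mp) orbF => /eqP; lra.
- split; first by rewrite h'l.
  rewrite h'r; last lra.
  rewrite addrAC subrr add0r; have [m0|m0] := eqVneq m 0.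
    rewrite m0 mul0r scale0r addr0; apply/esym/eqP.
    by rewrite -subr_eq0 -normr_eq0 -/q -/m m0.
  by rewrite divff // scale1r subrKC.
- split.
  + move=> s t sge0 st tm; case: ifP => ss0; case: ifP => ts0 //.
    * by apply: tauM => //; rewrite (le_trans ts0).
    * by move: ss0; rewrite (le_trans st).
  + by move=> s; case: ifP => // _; rewrite (leq_trans (tauN s)).
  + move=> s /andP[sge0 sm]; case: (leP s s0) => ss0.
      by rewrite h'l // taurho // sge0 (le_trans ss0).
    by apply: le_trans (prho n (ltnSn n)); apply: segm_dist; apply: Sh' => //; lra.
Qed.

End PolygonArc.

(** * Chains and cigars *)

Lemma unit_interval_induction (R : realType) (P : R -> Prop) : P 0 ->
  (forall t, 0 <= t <= 1 -> exists2 e, 0 < e &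
    forall a b, 0 <= a <= t -> t <= b <= 1 -> t - e < a -> b < t + e ->
      P a -> P b) ->
  P 1.
Proof.
move=> P0 Pstep; pose A := [set a | 0 <= a <= 1 /\ P a].
have A0 : A 0 by split; rewrite ?lexx ?ler01.
have hsA : has_sup A by split; [exists 0|exists 1 => a [/andP[]]].
have s0 : 0 <= sup A by exact: sup_upper_bound.
have s1 : sup A <= 1 by apply: ge_sup; [exists 0|move=> a [/andP[]]].
have [|e e0 Pe] := Pstep (sup A); first by rewrite s0.
have [a [/andP[a0 a1] Pa] aes] := sup_adherent e0 hsA.
have asup : a <= sup A by apply: sup_upper_bound => //; split; rewrite ?a0.
pose b := Num.min 1 (sup A + e / 2).
have bs : sup A <= b by rewrite le_min s1 /=; lra.
have b1 : b <= 1 by rewrite ge_min lexx.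
have be : b < sup A + e by rewrite gt_min; apply/orP; right; lra.
have Pb : P b by apply: (Pe a b); rewrite ?a0 ?bs.
have := sup_upper_bound hsA (conj _ Pb) => /(_ _)/wrap[].
  by rewrite b1 andbT (le_trans s0).
case: (leP 1 (sup A + e / 2)) => h; first by move=> _; move: Pb; rewrite /b min_l.
by rewrite /b (min_r (ltW h)) => ?; exfalso; lra.
Qed.

Section Chains.
Variables (R : realType) (E : normedModType R) (G : set E).
Hypotheses (GT : G <> setT) (oG : open G).
Local Notation d := (cdist G).

(** The factor 2 makes [cdist] comparable at consecutive points and on the
    segment between them; asking it at both ends makes chains reversible. *)
Definition gchain (n : nat) (p : nat -> E) :=
  (forall k, (k <= n)%N -> G (p k)) /\
  (forall k, (k < n)%N -> 2 * `|p k.+1 - p k| <= d (p k) /\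
                          2 * `|p k.+1 - p k| <= d (p k.+1)).

Definition catc n (p q : nat -> E) k := if (k <= n)%N then p k else q (k - n)%N.

Lemma catcl n p q k : (k <= n)%N -> catc n p q k = p k.
Proof. by rewrite /catc => ->. Qed.

Lemma catcr n p q k : q 0%N = p n -> catc n p q (n + k) = q k.
Proof.
move=> q0; rewrite /catc; case: leqP => h; last by rewrite addKn.
have -> : k = 0%N by lia.
by rewrite addn0.
Qed.

Lemma gchain_cat n m p q : gchain n p -> gchain m q -> q 0%N = p n ->
  gchain (n + m) (catc n p q).
Proof.
move=> [Gp cp] [Gq cq] q0; split=> k kn.
  have [h|h] := leqP k n; first by rewrite catcl //; apply: Gp.
  by rewrite -(subnKC (ltnW h)) catcr //; apply: Gq; lia.
have [h|h] := ltnP k n; first by rewrite !catcl //; [exact: cp|exact: ltnW].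
by rewrite -(subnKC h) -addnS !catcr //; apply: cq; lia.
Qed.

Lemma gchain_rev n p : gchain n p -> gchain n (fun k => p (n - k)%N).
Proof.
move=> [Gp cp]; split=> k kn; first by apply: Gp; lia.
have -> : (n - k)%N = (n - k.+1).+1 by lia.
by rewrite distrC; have [|? ?] := cp (n - k.+1)%N; [lia|split].
Qed.

(** Since [cdist] is positive at [g t], steps between parameters near [t] are
    admissible; [unit_interval_induction] plays the role of compactness. *)
Lemma curve_gchain (g : R -> E) : {within `[0, 1], continuous g} ->
    (forall t, 0 <= t <= 1 -> G (g t)) ->
  exists n (tau : nat -> R),
    [/\ tau 0%N = 0, tau n = 1,
        forall i j, (i <= j <= n)%N -> tau i <= tau j,
        forall i, (i <= n)%N -> 0 <= tau i <= 1
      & gchain n (g \o tau)].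
Proof.
move=> gc gG.
pose P (t : R) := exists n (tau : nat -> R),
    [/\ tau 0%N = 0, tau n = t,
        forall i j, (i <= j <= n)%N -> tau i <= tau j,
        forall i, (i <= n)%N -> 0 <= tau i <= 1
      & gchain n (g \o tau)].
apply: (@unit_interval_induction R P).
  exists 0%N, (fun=> 0); split=> //; first by move=> i _; rewrite lexx ler01.
  by split=> // k _; apply: gG; rewrite lexx ler01.
move=> t t01; have Gt := gG _ t01; have d0 := cdist_gt0 GT oG Gt.
have /subspace_continuousP/(_ t) := gc.
rewrite /= in_itv /= t01 => /(_ isT)/cvgrPdist_le/(_ (d (g t) / 8)).
case/(_ _)/wrap => [|]; first by lra.
rewrite near_withinE -nbhs_ballE => -[e /= e0 he].
have close s : 0 <= s <= 1 -> `|t - s| < e -> `|g t - g s| <= d (g t) / 8.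
  by move=> s01 ts; apply: he => //=; rewrite in_itv.
exists e => // a b /andP[a0 at_] /andP[tb b1] ta bt [n [tau [t0 tn tm ti tc]]].
have ha := close a; have hb := close b.
have {}ha : `|g t - g a| <= d (g t) / 8.
  by apply: ha; [move: t01 => /andP[]; lra|rewrite ger0_norm; lra].
have {}hb : `|g t - g b| <= d (g t) / 8.
  by apply: hb; [move: t01 => /andP[]; lra|rewrite distrC ger0_norm; lra].
have hab : `|g b - g a| <= d (g t) / 4.
  by have := ler_distD (g t) (g b) (g a); rewrite (distrC (g b) (g t)); lra.
have da := cdist_lip GT (g t) (g a); have db := cdist_lip GT (g t) (g b).
have b01 : 0 <= b <= 1 by lra.
exists n.+1, (fun k => if (k <= n)%N then tau k else b); split=> //=.
- by rewrite ltnn.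
- move=> i j /andP[ij jn]; case: (leqP i n) => hi; case: (leqP j n) => hj //.
  + by apply: tm; rewrite ij.
  + have : tau i <= tau n by apply: tm; rewrite hi leqnn.
    by rewrite tn; lra.
  + by have := leq_trans hi (leq_trans ij hj); rewrite ltnn.
- by move=> i _; case: leqP => // hi; exact: ti.
- split=> k; rewrite /= ?ltnS => kn.
    by case: leqP => h; apply: gG => //; exact: ti.
  have [h|h] := ltnP k n; first by rewrite ltnW //; exact: tc.2.
  have -> : k = n by apply/eqP; rewrite eqn_leq kn h.
  by rewrite leqnn tn; split; lra.
Qed.

(** Balls centred at the endpoints replace the diameters: this loses a factor
    at most 2 and makes the condition easy to transfer along chains. *)
Definition cigar_arc (C : R) (x1 x2 : E) := exists g : R -> E,
  [/\ arc_in G g, joins g x1 x2,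
      forall t, 0 <= t <= 1 -> `|g t - x1| <= C * `|x1 - x2| &
      forall t, 0 <= t <= 1 ->
        (forall s, 0 <= s <= t -> `|g s - x1| <= C * d (g t)) \/
        (forall s, t <= s <= 1 -> `|g s - x2| <= C * d (g t))].

Definition cigar_chain (A K : R) (x1 x2 : E) := exists n p,
  [/\ gchain n p, p 0%N = x1, p n = x2,
      forall k, (k <= n)%N -> `|p k - x1| <= A * `|x1 - x2| &
      forall k, (k <= n)%N ->
        (forall i, (i <= k)%N -> `|p i - x1| <= K * d (p k)) \/
        (forall i, (k <= i <= n)%N -> `|p i - x2| <= K * d (p k))].

(** By the Lipschitz property [d >= `|x1 - x2|] on the whole segment. *)
Lemma segment_cigar_arc (C : R) x1 x2 : x1 != x2 -> 1 <= C ->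
  2 * `|x1 - x2| < d x1 -> cigar_arc C x1 x2.
Proof.
move=> x12 C1 hd; have r0 : 0 < `|x1 - x2| by rewrite normr_gt0 subr_eq0.
pose g (t : R) := x1 + t *: (x2 - x1).
have gx1 t : 0 <= t -> `|g t - x1| = t * `|x1 - x2|.
  by move=> t0; rewrite /g addrC addKr normrZ ger0_norm // distrC.
have dg t : 0 <= t <= 1 -> `|x1 - x2| <= d (g t).
  move=> /andP[t0 t1]; have := cdist_lip GT x1 (g t); rewrite distrC gx1 //.
  have : t * `|x1 - x2| <= `|x1 - x2| by rewrite ler_piMl.
  by lra.
exists g; split.
- split; [split|].
  + apply: continuous_subspaceT => t.
    by apply: cvgD; [exact: cvg_cst|apply: cvgZr_tmp; exact: cvg_id].
  + move=> _ [t /= + <-]; rewrite in_itv /= => t01; have dgt := dg t t01.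
    by apply: (cdist_gt0_in (G := G)); apply: lt_le_trans dgt.
  + move=> s t _ _ /addrI/eqP; rewrite -subr_eq0 -scalerBl scaler_eq0 !subr_eq0.
    by rewrite [x2 == _]eq_sym (negPf x12) orbF => /eqP.
- by rewrite /joins /g scale0r addr0 scale1r subrKC.
- by move=> t /andP[t0 t1]; rewrite gx1 // ler_pM2r //; lra.
- move=> t t01; left=> s /andP[s0 st]; have := dg t t01; rewrite gx1 //; nra.
Qed.

(** The arc of [polygon_arc] stays within half of [cdist] of the vertices that
    index it, and its order is theirs.  The bound on [d x1] is needed because
    the steps of a chain are small compared with [d], not with
    [`|x1 - x2|]. *)
Lemma chain_cigar_arc (A K : R) x1 x2 : x1 != x2 -> 0 <= A -> 0 <= K ->
  d x1 <= 2 * `|x1 - x2| -> cigar_chain A K x1 x2 ->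
  cigar_arc (4 * K + 2 * A + 1) x1 x2.
Proof.
move=> x12 A0 K0 hd [n [p [[Gp cp] p0 pn pA pK]]].
have dge0 z : 0 <= d z by exact: cdist_ge0.
have r0 : 0 < `|x1 - x2| by rewrite normr_gt0 subr_eq0.
have [k kn|k|L [h [tau [L0 hc hinj [h0 hL] [tauM tauN taurho]]]]] :=
  @polygon_arc R E p (fun k => d (p k) / 2) n.
- by have [+ _] := cp k kn; lra.
- by have := dge0 (p k); lra.
have Lp : 0 < L.
  rewrite lt_neqAle L0 andbT; apply: contra_neq x12 => L00.
  by rewrite -p0 -pn -h0 -hL -L00.
have hdist s : 0 <= s <= L -> `|h s - p (tau s)| <= d (p (tau s)) / 2.
  exact: taurho.
have dh s : 0 <= s <= L -> d (p (tau s)) <= 2 * d (h s).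
  move=> sL; have := cdist_lip GT (p (tau s)) (h s); rewrite distrC.
  by have := hdist s sL; lra.
have Lt t : 0 <= t <= 1 -> 0 <= L * t <= L.
  by move=> /andP[t0 t1]; rewrite mulr_ge0 //= ler_piMr.
exists (fun t => h (L * t)); split.
- split; [split|].
  + apply: continuous_subspaceT => t.
    apply: (@continuous_comp _ _ _ (fun t => L * t) h); last exact: hc.
    by apply: cvgM; [exact: cvg_cst|exact: cvg_id].
  + move=> _ [t /= + <-]; rewrite in_itv /= => /Lt tL.
    apply: (cdist_gt0_in (G := G)); have := dh _ tL.
    by have := cdist_gt0 GT oG (Gp _ (tauN (L * t))); lra.
  + move=> s t; rewrite !in_itv /= => /Lt sL /Lt tL /hinj.
    by move=> /(_ sL tL)/mulfI; apply; rewrite gt_eqF.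
- by rewrite /joins mulr0 mulr1 h0 hL p0 pn.
- move=> t /Lt tL; set k := tau (L * t).
  have h1 := hdist _ tL; have kn : (k <= n)%N := tauN _.
  have h2 := pA k kn; have h3 := cdist_lip GT (p k) x1.
  have h4 := ler_distD (p k) (h (L * t)) x1.
  by rewrite -/k in h1; nra.
- move=> t t01; have tL := Lt t t01; set k := tau (L * t).
  have kn : (k <= n)%N := tauN _.
  have dk := dh _ tL; rewrite -/k in dk.
  have key z i s : 0 <= s <= L -> tau s = i -> `|p i - z| <= K * d (p k) ->
      `|p k - z| <= K * d (p k) ->
      `|h s - z| <= (4 * K + 2 * A + 1) * d (h (L * t)).
    move=> sL si iz kz; have h1 := hdist s sL; rewrite si in h1.
    have h2 := cdist_lip GT (p i) (p k).
    have h3 := ler_distD z (p i) (p k); rewrite (distrC z) in h3.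
    have h4 := ler_distD (p i) (h s) z.
    apply: (@le_trans _ _ ((2 * K + 2^-1) * d (p k))); first by nra.
    by have := dge0 (h (L * t)); nra.
  case: (pK k kn) => pz; [left|right] => s /andP[s1 s2].
  + have sL : 0 <= L * s <= L by apply: Lt; move: t01 => /andP[]; lra.
    apply: (key _ _ _ sL erefl); last exact: pz.
    apply: pz; apply: tauM; [by case/andP: sL| |by case/andP: tL].
    by rewrite ler_pM2l.
  + have sL : 0 <= L * s <= L by apply: Lt; move: t01 => /andP[]; lra.
    apply: (key _ _ _ sL erefl); last by apply: pz; rewrite leqnn.
    apply: pz; rewrite tauN andbT.
    by apply: tauM; [by case/andP: tL|rewrite ler_pM2l|by case/andP: sL].
Qed.

Lemma cigar_arc_of_chain (A K : R) x1 x2 : x1 != x2 -> 0 <= A -> 0 <= K ->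
  (d x1 <= 2 * `|x1 - x2| -> cigar_chain A K x1 x2) ->
  cigar_arc (4 * K + 2 * A + 1) x1 x2.
Proof.
move=> x12 A0 K0 h; have [hd|hd] := leP (d x1) (2 * `|x1 - x2|).
  by apply: chain_cigar_arc => //; exact: h.
by apply: segment_cigar_arc => //; lra.
Qed.

End Chains.

(** * Cigars, uniform arcs and the min-max property *)

Lemma curve_length_ge (R : realType) (E : normedModType R) (g : R -> E)
    (a b s : R) : a <= s <= b ->
  ((`|g s - g a| + `|g b - g s|)%:E <= curve_length a b g)%E.
Proof.
move=> /andP[as_ sb].
have len t x : itv_partition a b t -> x = polygon_length a b g t ->
    (x%:E <= curve_length a b g)%E.
  by move=> tP ->; apply: ereal_sup_ubound; exists t.
have [ab|ab] := eqVneq a b.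
  have es : s = a by apply/eqP; rewrite eq_le as_ ab sb.
  apply: (len [::]); first by split; rewrite //= ab.
  by rewrite /polygon_length big_geq // es ab subrr normr0 addr0.
have a_lt_b : a < b by rewrite lt_neqAle ab (le_trans as_).
have [es|sa] := eqVneq s a.
  apply: (len [:: b]); first by split; rewrite //= a_lt_b.
  by rewrite /polygon_length big_nat1 /= es subrr normr0 add0r.
have [es|sb'] := eqVneq s b.
  apply: (len [:: b]); first by split; rewrite //= a_lt_b.
  by rewrite /polygon_length big_nat1 /= es subrr normr0 addr0.
apply: (len [:: s; b]).
  by split; rewrite //= !lt_neqAle as_ sb sb' eq_sym sa.
by rewrite /polygon_length big_nat_recl //= big_nat1.
Qed.

Section Implications.
Variables (R : realType) (E : normedModType R) (G : set E).
Hypotheses (GT : G <> setT) (oG : open G).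
Local Notation d := (cdist G).

Definition cigar_domain (C : R) :=
  forall x1 x2, G x1 -> G x2 -> x1 != x2 -> cigar_arc G C x1 x2.

Lemma uniform_cigar c : uniform_domain c G -> cigar_domain c.
Proof.
move=> uG x1 x2 G1 G2 x12; have [g [ag jg lg mg]] := uG _ _ G1 G2 x12.
have [g0 g1] := jg; have [[_ gG] _] := ag.
have itv (t : R) : 0 <= t <= 1 -> t \in `[0, 1] by rewrite in_itv.
exists g; split=> // t t01; have tI := itv t t01.
  rewrite -lee_fin; apply: le_trans lg.
  apply: le_trans (curve_length_ge g t01); rewrite lee_fin g0.
  by rewrite lerDl.
have Gt : G (g t) by apply: gG; exists t => //=; rewrite in_itv.
have := mg t tI; rewrite (boundary_distE GT oG Gt) -EFinM ge_min.
case/orP => h; [left|right] => s s01; rewrite -lee_fin; apply: le_trans h.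
  by apply: le_trans (curve_length_ge g s01); rewrite lee_fin g0 lerDl.
apply: le_trans (curve_length_ge g s01); rewrite lee_fin g1.
by rewrite [`|x2 - _|]distrC lerDr.
Qed.

Lemma diam_uniform_cigar c : diam_uniform_domain c G -> cigar_domain c.
Proof.
move=> uG x1 x2 G1 G2 x12; have [g [ag jg lg mg]] := uG _ _ G1 G2 x12.
have [g0 g1] := jg; have [[_ gG] _] := ag.
have img (a b t : R) : a <= t <= b -> (g @` `[a, b]) (g t).
  by move=> t01; exists t => //=; rewrite in_itv.
exists g; split=> // t t01.
  move/diam_leP: lg; apply; first exact: img.
  by rewrite -g0; apply: img; rewrite lexx ler01.
have /andP[t0 t1] := t01.
have := mg t; rewrite in_itv /= => /(_ t01).
rewrite (boundary_distE GT oG (gG _ (img _ _ _ t01))) -EFinM ge_min.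
case/orP => /diam_leP h; [left|right] => s s01; apply: h; try exact: img.
  by rewrite -g0; apply: img; rewrite lexx.
by rewrite -g1; apply: img; rewrite lexx andbT.
Qed.

Lemma cigar_diam_uniform C : cigar_domain C -> diam_uniform_domain (2 * C) G.
Proof.
move=> uG x1 x2 G1 G2 x12; have [g [ag jg lg mg]] := uG _ _ G1 G2 x12.
have [[_ gG] _] := ag.
exists g; split=> //.
  apply/diam_leP => _ _ [s /= + <-] [t /= + <-]; rewrite !in_itv /= => s01 t01.
  have := ler_distD x1 (g s) (g t); rewrite (distrC x1).
  by have := lg s s01; have := lg t t01; lra.
move=> t; rewrite in_itv /= => t01.
have Gt : G (g t) by apply: gG; exists t => //=; rewrite in_itv.
rewrite (boundary_distE GT oG Gt) -EFinM ge_min.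
apply/orP; case: (mg t t01) => h; [left|right]; apply/diam_leP;
  move=> _ _ [s /= + <-] [u /= + <-]; rewrite !in_itv /= => hs hu;
  have := h s hs; have := h u hu.
  by have := ler_distD x1 (g s) (g u); rewrite (distrC x1); lra.
by have := ler_distD x2 (g s) (g u); rewrite (distrC x2); lra.
Qed.

(** With [rho] the larger distance from [y] to the outer points, [d <= rho] at
    both of them.  If one outer point has its small side towards the middle
    point, the latter is within a multiple of [rho] of an endpoint.  In the
    remaining case each outer point is near its own endpoint, hence the
    endpoints are within a multiple of [rho] of each other and the bound on
    the whole arc applies. *)
Lemma cigar_min_max c : 1 <= c -> cigar_domain c -> min_max_property G.
Proof.
move=> c1 cG; pose C := (1 + c) * (1 + 2 * c).
have C1 : 1 <= C by rewrite /C; nra.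
have C0 : 0 < C by lra.
exists [set g | curve_in G g /\ forall s t u : R,
    0 <= s -> s <= t -> t <= u -> u <= 1 -> forall y, boundary G y ->
      C^-1 * Num.min `|g s - y| `|g u - y| <= `|g t - y| /\
      `|g t - y| <= C * Num.max `|g s - y| `|g u - y|], C.
split=> //; [by move=> g []| |by move=> g []].
move=> x1 x2 G1 G2; have [x12|x12] := eqVneq x1 x2.
  exists (fun=> x1); last by split.
  split; first split.
  - by apply: continuous_subspaceT => t; exact: cvg_cst.
  - by move=> _ [t _ <-].
  - move=> s t u _ _ _ _ y _; rewrite minxx maxxx; split.
      by rewrite mulrC ler_pdivrMr // ler_peMr.
    by rewrite ler_peMl.
have [g [[cg _] jg lg mg]] := cG _ _ G1 G2 x12.
exists g => //; split=> // s t u s0 st tu u1 y By.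
have [g0 g1] := jg.
have Gy := boundary_notin oG By.
have dy z : d z <= `|z - y| by exact: cdist_le.
have s01 : 0 <= s <= 1 by lra.
have t01 : 0 <= t <= 1 by lra.
have u01 : 0 <= u <= 1 by lra.
have cC : 1 + 2 * c <= C by rewrite /C; nra.
split.
  rewrite mulrC ler_pdivrMr // ge_min; apply/orP.
  have bound z z' : `|g z - z'| <= c * d (g t) -> `|g t - z'| <= c * d (g t) ->
      `|g z - y| <= `|g t - y| * C.
    move=> hz ht; have := ler_distD z' (g z) (g t).
    have := ler_distD (g t) (g z) y; rewrite (distrC z').
    have : c * d (g t) <= c * `|g t - y| by rewrite ler_pM2l ?dy //; lra.
    have : (1 + 2 * c) * `|g t - y| <= C * `|g t - y| by rewrite ler_wpM2r.
    by lra.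
  by case: (mg t t01) => h; [left; apply: (bound _ x1)|right; apply: (bound _ x2)];
    apply: h; lra.
set rho := Num.max _ _.
have sr : `|g s - y| <= rho by rewrite le_max lexx.
have ur : `|g u - y| <= rho by rewrite le_max lexx orbT.
have rho0 : 0 <= rho by exact: le_trans sr.
have bound z z' : `|z - y| <= rho -> `|z - z'| <= c * rho ->
    `|g t - z'| <= c * rho -> `|g t - y| <= C * rho.
  move=> h1 h2 h3; have := ler_distD z' (g t) z.
  by have := ler_distD z (g t) y; rewrite (distrC z'); nra.
have dsr : c * d (g s) <= c * rho.
  by rewrite ler_pM2l ?(le_trans (dy _)) //; lra.
have dur : c * d (g u) <= c * rho.
  by rewrite ler_pM2l ?(le_trans (dy _)) //; lra.
case: (mg u u01) => hu.
  by apply: (bound _ x1 ur); apply: le_trans dur; apply: hu; lra.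
case: (mg s s01) => hs; last first.
  by apply: (bound _ x2 sr); apply: le_trans dsr; apply: hs; lra.
have hs1 : `|g s - x1| <= c * rho by apply: le_trans dsr; apply: hs; lra.
have hu1 : `|g u - x2| <= c * rho by apply: le_trans dur; apply: hu; lra.
have x12r : `|x1 - x2| <= (2 * c + 2) * rho.
  have e1 := ler_distD (g s) x1 x2; have e2 := ler_distD y (g s) x2.
  have e3 := ler_distD (g u) y x2.
  by rewrite (distrC x1 (g s)) in e1; rewrite (distrC y (g u)) in e3; lra.
have := lg t t01; have := ler_distD x1 (g t) (g s).
have := ler_distD (g s) (g t) y; rewrite (distrC x1 (g s)) /C.
have : c * `|x1 - x2| <= c * ((2 * c + 2) * rho) by rewrite ler_pM2l //; lra.
by lra.
Qed.

(** The second min-max inequality, with a boundary point near [x1], bounds the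
    curve; the first one, with a boundary point near the current point, forces
    all earlier points or all later points to be close.  Both are inequalities
    between parameters in order, so they pass to chains sampled on the
    curve. *)
Lemma min_max_cigar : min_max_property G ->
  exists2 C, 1 <= C & cigar_domain C.
Proof.
case=> Gam [c [c1 Gamc Gamj Gamm]].
exists (4 * (4 * c) + 2 * (10 * c) + 1); first by lra.
move=> x1 x2 G1 G2 x12; apply: cigar_arc_of_chain => //; [lra|lra|].
move=> hd; have [g Gg [g0 g1]] := Gamj _ _ G1 G2; have [gc gG] := Gamc _ Gg.
have r0 : 0 < `|x1 - x2| by rewrite normr_gt0 subr_eq0.
have [|n [tau [t0 tn tm ti tc]]] := curve_gchain GT oG gc.
  by move=> t t01; apply: gG; exists t => //=; rewrite in_itv.
exists n, (g \o tau); split => //=; rewrite ?t0 ?tn // => k kn.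
- have [y By xy] := boundary_near GT oG G1.
  have /andP[tk0 tk1] := ti k kn.
  have [_] := Gamm g Gg 0 (tau k) 1 (lexx _) tk0 tk1 (lexx _) y By.
  rewrite g0 g1; set m := Num.max _ _ => hk.
  have m5 : m <= 5 * `|x1 - x2|.
    rewrite ge_max; apply/andP; split; first by lra.
    by have := ler_distD x1 x2 y; rewrite (distrC x2 x1); lra.
  have := ler_distD y (g (tau k)) x1; rewrite (distrC y) => h.
  have : c * m <= c * (5 * `|x1 - x2|) by rewrite ler_pM2l //; lra.
  by nra.
- have Gk := tc.1 k kn; have [y By ky] := boundary_near GT oG Gk.
  have dk0 := cdist_gt0 GT oG Gk.
  (* No point before [k] and point after [k] are both far from [y]. *)
  pose far i := 2 * c * d (g (tau k)) < `|g (tau i) - y|.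
  have tri i z : `|g (tau i) - y| <= 2 * c * d (g (tau k)) ->
      `|z - y| <= 2 * c * d (g (tau k)) ->
      `|g (tau i) - z| <= 4 * c * d (g (tau k)).
    by have := ler_distD y (g (tau i)) z; rewrite (distrC y); lra.
  have sep i j : (i <= k <= j)%N -> (j <= n)%N -> far i -> far j -> False.
    move=> /andP[ik kj] jn fi fj.
    have [||||+ _] := Gamm g Gg (tau i) (tau k) (tau j) _ _ _ _ y By.
    + by have /andP[] := ti i (leq_trans ik kn).
    + by apply: tm; rewrite ik.
    + by apply: tm; rewrite kj.
    + by have /andP[] := ti j jn.
    rewrite mulrC ler_pdivrMr; last by lra.
    have : 2 * c * d (g (tau k)) < Num.min `|g (tau i) - y| `|g (tau j) - y|.
      by rewrite lt_min; apply/andP; split.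
    have : `|g (tau k) - y| * c <= 2 * d (g (tau k)) * c by rewrite ler_pM2r //; lra.
    by lra.
  have [[i ik fi]|nof] := pselect (exists2 i, (i <= k)%N & far i).
    right=> j /andP[kj jn]; apply: tri; rewrite leNgt; apply/negP.
      by apply: (sep i) => //; rewrite ik.
    have -> : x2 = g (tau n) by rewrite tn g1.
    by apply: (sep i n) => //; rewrite ik.
  left=> j jk; apply: tri; rewrite leNgt; apply/negP => h; apply: nof.
    by exists j.
  by exists 0%N => //; rewrite /far t0 g0.
Qed.

Lemma cigar_delta_uniform c : 1 <= c -> cigar_domain c ->
  delta_uniform_domain ((c + 1) * (c + 2))^-1 G.
Proof.
move=> c1 cG x1 x2 G1 G2 x12; have [g [ag jg lg mg]] := cG _ _ G1 G2 x12.
exists g; split=> // x y [t /= + <-]; rewrite in_itv /= => t01 gx1 gx2 Gy.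
pose r := `|x1 - x2|; pose b := `|g t - y|; pose K := (c + 1) * (c + 2).
have K0 : 0 < K by rewrite /K; nra.
have pos (u v : E) : u != v -> 0 < `|u - v| by rewrite normr_gt0 subr_eq0.
have Gne z : G z -> z != y.
  by move=> Gz; apply/negP => /eqP e; apply: Gy; rewrite -e.
have r0 : 0 < r by exact: pos.
have b0 : 0 <= b by exact: normr_ge0.
have ratio (u v : R) : 0 < u -> 0 < v -> u <= (c + 1) * r -> v <= r + u + b ->
    u <= c * b \/ v <= (c + 1) * b -> K^-1 <= b / u * (r / v).
  move=> u0 v0 ur vr uv.
  rewrite mulrACA -invfM ler_pdivlMr ?mulr_gt0 // mulrC ler_pdivrMr //.
  have br0 : 0 <= b * r by rewrite mulr_ge0 // ltW.
  case: uv => h.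
    apply: (@le_trans _ _ (c * b * r + (c + 1) * r * (c * b + b))).
      apply: (@le_trans _ _ (u * r + u * (u + b))).
        by rewrite -mulrDr addrA ler_pM2l.
      apply: lerD; first by rewrite ler_pM2r.
      by apply: ler_pM => //; [exact: ltW|lra|lra].
    by rewrite /K; nra.
  apply: (@le_trans _ _ ((c + 1) * r * ((c + 1) * b))).
    by apply: ler_pM => //; exact: ltW.
  by rewrite /K; nra.
have dc : c * d (g t) <= c * b by rewrite ler_pM2l ?cdist_le //; lra.
have h1 := lg t t01; rewrite -/r in h1.
have e1 := ler_distD x1 (g t) x2; rewrite -/r in e1.
have e2 := ler_distD (g t) x2 y; rewrite (distrC x2 (g t)) -/b in e2.
have e3 := ler_distD (g t) x1 y; rewrite (distrC x1 (g t)) -/b in e3.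
have e4 := ler_distD x1 x2 y; rewrite (distrC x2 x1) -/r in e4.
have e5 := ler_distD x2 x1 y; rewrite -/r in e5.
have hmin : `|g t - x1| <= c * b \/ `|g t - x2| <= c * b.
  have /andP[t0 t1] := t01.
  case: (mg t t01) => h; [left|right]; apply: le_trans dc; apply: h.
    by rewrite lexx t0.
  by rewrite lexx t1.
split.
  apply: ratio; rewrite ?pos ?Gne //; [lra|lra|].
  by case: hmin => h; [left|right; lra].
rewrite (distrC x2 x1); apply: ratio; rewrite ?pos ?Gne //; [lra|lra|].
by case: hmin => h; [right; lra|left].
Qed.

End Implications.

(** * Joining half cigars *)

Section Linking.
Variables (R : realType) (E : normedModType R) (G : set E).
Hypotheses (GT : G <> setT) (oG : open G).
Local Notation d := (cdist G).
Local Notation gchain := (gchain G).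

Lemma catc_split n m (p q : nat -> E) k : q 0%N = p n -> (k <= n + m)%N ->
  (k <= n)%N /\ catc n p q k = p k \/
  exists j, [/\ (j <= m)%N, k = (n + j)%N & catc n p q k = q j].
Proof.
move=> q0 km; have [kn|nk] := leqP k n; first by left; rewrite catcl.
right; exists (k - n)%N; split.
- by rewrite leq_subLR.
- by rewrite subnKC // ltnW.
- by rewrite -{1}(subnKC (ltnW nk)) catcr.
Qed.

Definition linked (S : set E) x y := exists n p,
  [/\ gchain n p, p 0%N = x, p n = y & forall k, (k <= n)%N -> S (p k)].

Lemma linked_sym S x y : linked S x y -> linked S y x.
Proof.
case=> n [p [cp p0 pn pS]]; exists n, (fun k => p (n - k)%N); split.
- exact: gchain_rev.
- by rewrite subn0.
- by rewrite subnn.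
- by move=> k kn; apply: pS; rewrite leq_subr.
Qed.

Lemma linked_trans S x y z : linked S x y -> linked S y z -> linked S x z.
Proof.
case=> n [p [cp p0 pn pS]] [m [q [cq q0 qm qS]]].
have qp : q 0%N = p n by rewrite q0 pn.
exists (n + m)%N, (catc n p q); split.
- exact: gchain_cat.
- by rewrite catcl.
- by rewrite catcr.
- move=> k /(catc_split qp)[[kn ->]|[j [jm _ ->]]]; [exact: pS|exact: qS].
Qed.

(** One half of a cigar, with vertex [x]. *)
Definition climbing (K M : R) x z := exists n p,
  [/\ gchain n p, p 0%N = x, p n = z,
      forall i, (i <= n)%N -> `|p i - x| <= M
    & forall i j, (i <= j <= n)%N -> `|p i - x| <= K * d (p j)].

(** Two half cigars are joined by a middle part on which [d] is at least
    [`|x1 - x2| / A]; there the bound on the whole chain is enough. *)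
Lemma join_climbing (A K : R) x1 x2 z1 z2 : 0 <= A -> 0 <= K ->
    climbing K (A * `|x1 - x2|) x1 z1 -> climbing K (A * `|x1 - x2|) x2 z2 ->
    linked [set z | `|z - x1| <= A * `|x1 - x2| /\ `|x1 - x2| <= A * d z] z1 z2 ->
  cigar_chain G (A + 1) (K + A * A) x1 x2.
Proof.
move=> A0 K0 [n [p [cp p0 pn pA pK]]] [n' [p' [cp' p0' pn' pA' pK']]].
case=> m [q [cq q0 qm qS]].
set r := `|x1 - x2| in pA pA' qS *.
have r0 : 0 <= r by exact: normr_ge0.
pose s k := p' (n' - k)%N.
have qp : q 0%N = p n by rewrite q0 pn.
pose c1 := catc n p q; pose c := catc (n + m) c1 s.
have sc1 : s 0%N = c1 (n + m)%N by rewrite /s subn0 pn' /c1 catcr.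
have cc1 : gchain (n + m) c1 by exact: gchain_cat.
have cs : gchain n' s by exact: gchain_rev.
have c1A i : (i <= n + m)%N -> `|c1 i - x1| <= A * r.
  by rewrite /c1 => /(catc_split qp)[[kn ->]|[j [jm _ ->]]];
    [exact: pA|have [] := qS j jm].
have dge0 z : 0 <= d z by exact: cdist_ge0.
have KA z : K * d z <= (K + A * A) * d z.
  by rewrite ler_wpM2r // lerDl mulr_ge0.
exists (n + m + n')%N, c; split.
- exact: gchain_cat.
- by rewrite /c !catcl.
- by rewrite /c catcr // /s subnn.
- move=> k /(catc_split sc1)[[kn e]|[j [jm _ e]]]; rewrite /c e.
    by apply: le_trans (c1A k kn) _; rewrite ler_wpM2r // lerDl.
  have := ler_distD x2 (s j) x1; rewrite (distrC x2) -/r.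
  by have := pA' (n' - j)%N (leq_subr _ _); rewrite -/(s j) -/r; lra.
- move=> k /(catc_split sc1)[[kn e]|[j [jm ke e]]]; rewrite /c e.
    left=> i ik; have inm := leq_trans ik kn.
    have -> : catc (n + m) c1 s i = c1 i by rewrite catcl.
    move: (catc_split qp kn) => [[kn' e']|[j [jm _ e']]]; rewrite {2}/c1 e'.
      rewrite /c1 catcl ?(leq_trans ik) //; apply: le_trans (KA _).
      by apply: pK; rewrite ik.
    apply: le_trans (c1A i inm) _; have [_ hq] := qS j jm.
    apply: (@le_trans _ _ (A * (A * d (q j)))); first exact: ler_wpM2l.
    by rewrite mulrA ler_wpM2r // lerDr.
  (* In the reversed second half the order of indices is reversed, and so are
     the roles of earlier and later points. *)
  right=> i /andP[ki ile].
  move: (catc_split sc1 ile) => [[inm _]|[i' [i'n ie ->]]].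
    (* The junction point belongs to both concatenated chains. *)
    have j0 : j = 0%N by clear -ki inm ke; lia.
    have -> : i = (n + m)%N by clear -ki inm ke; lia.
    rewrite catcl // -sc1 j0; apply: le_trans (KA _); apply: pK'.
    by rewrite subn0 leqnn.
  apply: le_trans (KA _); apply: pK'; rewrite leq_subr andbT.
  by apply: leq_sub2l; move: ki; rewrite ke ie leq_add2l.
Qed.

Section Climb.
Variable C : R.
Hypothesis C1 : 1 <= C.
Hypothesis distance_cigar : forall x1 x2, G x1 -> G x2 ->
  linked [set z | Num.min `|z - x1| `|z - x2| <= C * d z] x1 x2.

(** Follow a distance cigar from [z] towards the remote point [w] until it
    leaves the ball of radius [s := 2 * C * d z].  Up to there [z] is the
    nearer endpoint, so [d] is at least the distance to [z] divided by [C],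
    which is at least [2 * d z] at the exit point. *)
Lemma climb_step z w : G z -> G w -> 8 * C * d z <= `|z - w| -> exists n q,
  [/\ gchain n q, q 0%N = z, 2 * d z <= d (q n) &
      forall j, (j <= n)%N -> `|q j - z| <= 4 * C * d z /\
                              d z <= (C + 1) * d (q j)].
Proof.
move=> Gz Gw zw; have d0 := cdist_gt0 GT oG Gz.
have [n [p [[Gp cp] p0 pn pS]]] := distance_cigar Gz Gw.
have Cd : 0 < C * d z by rewrite mulr_gt0 // (lt_le_trans ltr01).
pose s := 2 * C * d z.
have ds : 2 * d z <= s by rewrite /s -mulrA ler_pM2l // ler_peMl // ltW.
have far : exists k, (k <= n)%N && (s <= `|p k - z|).
  by exists n; rewrite leqnn pn distrC /s /=; lra.
case: (ex_minnP far) => -[|k] /andP[kn sk] kmin.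
  by move: sk; rewrite p0 subrr normr0; lra.
have near j : (j <= k)%N -> `|p j - z| < s.
  move=> jk; rewrite ltNge; apply/negP => h; have := kmin j.
  by rewrite h andbT (leq_trans jk (ltnW kn)) => /(_ isT); rewrite ltnNge jk.
have bound j : (j <= k.+1)%N -> `|p j - z| <= 2 * s.
  rewrite leq_eqVlt => /orP[/eqP ->|]; last by rewrite ltnS => /near; lra.
  have [h _] := cp k kn; have := cdist_lip GT (p k) z.
  by have := near k (leqnn k); have := ler_distD (p k) (p k.+1) z; lra.
have dj j : (j <= k.+1)%N -> `|p j - z| <= C * d (p j).
  move=> jk; have := pS j (leq_trans jk kn); rewrite /= min_l //.
  have := bound j jk; have := ler_distD (p j) z w.
  by rewrite (distrC z (p j)) /s; lra.
exists k.+1, p; split => //.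
- split=> j jk; first by apply: Gp; exact: leq_trans kn.
  by apply: cp; exact: leq_trans kn.
- have h := dj k.+1 (leqnn _).
  have C0 : 0 < C by exact: lt_le_trans C1.
  rewrite -(ler_pM2l C0).
  by apply: le_trans h; apply: le_trans sk; rewrite /s; lra.
- move=> j jk; split; first by have := bound j jk; rewrite /s; lra.
  have := cdist_lip GT z (p j); rewrite distrC.
  by have := dj j jk; lra.
Qed.

(** Iterates [climb_step].  Since [d] at least doubles, the steps already made
    add up to a multiple of the current [d], which gives the cigar condition,
    and [w] stays remote until [d] is comparable to [`|x - w|]. *)
Lemma climb x w : G x -> G w -> x != w ->
  exists z, climbing (8 * C * (C + 1)) `|x - w| x z /\ `|x - w| <= 12 * C * d z.
Proof.
move=> Gx Gw xw; set r := `|x - w|.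
have r0 : 0 < r by rewrite normr_gt0 subr_eq0.
have d0 := cdist_gt0 GT oG Gx.
have dge0 z : 0 <= d z by exact: cdist_ge0.
have Cp : 0 < C by exact: lt_le_trans C1.
have C0 := ltW Cp.
have step m : exists n p, [/\ gchain n p, p 0%N = x,
    2 ^+ m * d x <= d (p n) \/ r <= 12 * C * d (p n),
    forall i, (i <= n)%N -> `|p i - x| <= 4 * C * d (p n) /\ `|p i - x| <= r
  & forall i j, (i <= j <= n)%N -> `|p i - x| <= 8 * C * (C + 1) * d (p j)].
  elim: m => [|m [n [p [cp p0 pn pr pK]]]].
    exists 0%N, (fun=> x); split=> //.
    - by left; rewrite expr0 mul1r.
    - by move=> i _; rewrite subrr normr0 !mulr_ge0 // ltW.
    - by move=> i j _; rewrite subrr normr0 !mulr_ge0 // addr_ge0.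
  have [h|h] := leP r (12 * C * d (p n)).
    by exists n, p; split=> //; right.
  have pn' : 2 ^+ m * d x <= d (p n) by case: pn => //; rewrite leNgt h.
  have [prn _] := pr n (leqnn _).
  have Gpn := cp.1 n (leqnn _).
  have [|k [q [cq q0 qk qj]]] := climb_step Gpn Gw.
    by have := ler_distD (p n) x w; rewrite -/r (distrC x); lra.
  have new i : (i <= n + k)%N -> `|catc n p q i - x| <= 8 * C * d (p n).
    move=> /(catc_split q0)[[kn ->]|[j [jm _ ->]]].
      by have [+ _] := pr i kn; have := mulr_ge0 C0 (dge0 (p n)); lra.
    by have [+ _] := qj j jm; have := ler_distD (p n) (q j) x; lra.
  exists (n + k)%N, (catc n p q); split.
  - exact: gchain_cat.
  - by rewrite catcl.
  - by left; rewrite catcr // exprS -mulrA; lra.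
  - move=> i ik; have := new i ik; rewrite catcr //.
    have : 4 * C * (2 * d (p n)) <= 4 * C * d (q k) by rewrite ler_pM2l //; lra.
    by split; lra.
  - move=> i j /andP[ij jk].
    move: (catc_split q0 jk) => [[jn ->]|[j' [j'k _ ->]]].
      by rewrite catcl ?(leq_trans ij) //; apply: pK; rewrite ij.
    apply: le_trans (new i (leq_trans ij jk)) _.
    have [_ h'] := qj j' j'k.
    by rewrite -[leRHS]mulrA ler_pM2l //; lra.
have [m hm] : exists m : nat, r <= 12 * C * (2 ^+ m * d x).
  exists (Num.bound (r / d x)).
  have h1 : r / d x <= 2 ^+ Num.bound (r / d x).
    apply: ltW; apply: lt_trans (archi_boundP _) _.
      by rewrite divr_ge0 // ltW.
    by rewrite -natrX ltr_nat ltn_expl.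
  have h2 : 0 <= 2 ^+ Num.bound (r / d x) * d x by rewrite mulr_ge0 ?exprn_ge0.
  rewrite ler_pdivrMr // in h1; apply: le_trans h1 _.
  by rewrite ler_peMl //; have := C1; lra.
have [n [p [cp p0 pn pr pK]]] := step m.
exists (p n); split.
  by exists n, p; split=> // i /pr[].
case: pn => // h; apply: le_trans hm _; rewrite ler_pM2l //; lra.
Qed.

End Climb.
End Linking.

(** * Directions off a line *)

Section Plane.
Variables (R : realType) (E : normedModType R).
Implicit Types u v e : E.

Definition off_line (c : R) e u := forall lam : R, c <= `|e - lam *: u|.

(** The infimum over the line is attained: large multiples of [v] are farther
    from [u] than 0 is, and the remaining ones form a compact set. *)
Lemma off_line_indep u v : u != 0 -> v != 0 ->
    (forall lam : R, u - lam *: v != 0) ->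
  exists2 c, 0 < c & off_line c u v.
Proof.
move=> u0 v0 uv; have nu : 0 < `|u| by rewrite normr_gt0.
have nv : 0 < `|v| by rewrite normr_gt0.
pose M := 2 * `|u| / `|v|; pose f (lam : R) : R := `|u - lam *: v|.
have M0 : 0 <= M by rewrite /M divr_ge0 ?mulr_ge0 // ltW.
have fc : continuous f.
  move=> x; apply: (@continuous_comp _ _ _ (fun lam : R => u - lam *: v) Num.norm).
    by apply: cvgB; [exact: cvg_cst|apply: cvgZr_tmp; exact: cvg_id].
  exact: norm_continuous.
have [|s sM smin] := @EVT_min R f (- M) M _ (continuous_subspaceT fc).
  by lra.
exists (Num.min (f s) `|u|); first by rewrite lt_min normr_gt0 uv nu.
move=> lam; rewrite ge_min; have [hlam|hlam] := leP `|lam| M.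
  by apply/orP; left; apply: smin; rewrite in_itv /= -ler_norml.
apply/orP; right; have := lerB_dist (lam *: v) u; rewrite normrZ distrC.
by move: hlam; rewrite /M ltr_pdivrMr //; lra.
Qed.

(** Two fixed unit vectors such that every line through 0 stays away from one
    of them.  If [u] had multiples close to both, the corresponding multiples
    of [e1] and [e2] would nearly cancel, against independence.  Having the
    constant [c] independent of [u] replaces compactness of the sphere. *)
Lemma two_directions : dim_ge2 E -> exists e1 e2 (c : R),
  [/\ `|e1| = 1, `|e2| = 1, 0 < c, c <= 1 / 2 &
      forall u, off_line c e1 u \/ off_line c e2 u].
Proof.
case=> v1 [v2 indep].
have v1N0 : v1 != 0.
  apply/eqP => v10; have [|] := indep 1 0.
    by rewrite v10 scaler0 scale0r addr0.
  by move/eqP; rewrite oner_eq0.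
have v2N0 : v2 != 0.
  apply/eqP => v20; have [|] := indep 0 1.
    by rewrite v20 scaler0 scale0r addr0.
  by move=> _ /eqP; rewrite oner_eq0.
pose e1 := `|v1|^-1 *: v1; pose e2 := `|v2|^-1 *: v2.
have n1 : `|e1| = 1 by rewrite normfZV.
have n2 : `|e2| = 1 by rewrite normfZV.
have e1N0 : e1 != 0 by rewrite -normr_eq0 n1 oner_eq0.
have e2N0 : e2 != 0 by rewrite -normr_eq0 n2 oner_eq0.
have i1 (lam : R) : e1 - lam *: e2 != 0.
  apply/eqP => h; have [|] := indep `|v1|^-1 (- (lam * `|v2|^-1)).
    by rewrite scaleNr -scalerA.
  by move/eqP; rewrite invr_eq0 normr_eq0 (negPf v1N0).
have i2 (lam : R) : e2 - lam *: e1 != 0.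
  apply/eqP => h; have [|] := indep (- (lam * `|v1|^-1)) `|v2|^-1.
    by rewrite scaleNr -scalerA addrC.
  by move=> _ /eqP; rewrite invr_eq0 normr_eq0 (negPf v2N0).
have [c1 c10 h1] := off_line_indep e1N0 e2N0 i1.
have [c2 c20 h2] := off_line_indep e2N0 e1N0 i2.
have lower (k : R) (a e e' : E) (l : R) : 0 < k -> off_line k e e' ->
    a = l *: e' -> forall b : R, k * `|b| <= `|b *: e - a|.
  move=> k0 h -> b; have [->|b0] := eqVneq b 0.
    by rewrite normr0 mulr0.
  have -> : b *: e - l *: e' = b *: (e - (b^-1 * l) *: e').
    by rewrite scalerBr scalerA mulrA divff // mul1r.
  by rewrite normrZ mulrC ler_pM2l ?normr_gt0.
pose k := Num.min c1 c2.
have k0 : 0 < k by rewrite lt_min c10.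
have k1 : k <= 1.
  by have := h1 0; rewrite scale0r subr0 n1; apply: le_trans; rewrite ge_min lexx.
exists e1, e2, (k / 2); split => //; [lra|lra|].
move=> u; apply: contrapT => /not_orP[/existsNP[a /negP ha] /existsNP[b /negP hb]].
rewrite -ltNge in ha; rewrite -ltNge in hb.
have w : b *: e1 - a *: e2 = b *: (e1 - a *: u) - a *: (e2 - b *: u).
  by rewrite !scalerBr !scalerA (mulrC b a) opprB addrA subrK.
have wb : k * `|b| <= `|b *: e1 - a *: e2|.
  apply: le_trans (lower c1 _ _ _ a c10 h1 erefl b).
  by rewrite ler_wpM2r // ge_min lexx.
have wa : k * `|a| <= `|b *: e1 - a *: e2|.
  rewrite distrC; apply: le_trans (lower c2 _ _ _ b c20 h2 erefl a).
  by rewrite ler_wpM2r // ge_min lexx orbT.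
have wub := ler_normB (b *: (e1 - a *: u)) (a *: (e2 - b *: u)).
rewrite -w !normrZ in wub.
have a0 : 0 < `|a|.
  rewrite normr_gt0; apply/eqP => a0; move: ha; rewrite a0 scale0r subr0 n1.
  by lra.
have h3 : `|a| * `|e2 - b *: u| < `|a| * (k / 2) by rewrite ltr_pM2l.
have h4 : `|b| * `|e1 - a *: u| <= `|b| * (k / 2) by rewrite ler_wpM2l // ltW.
by lra.
Qed.

(** Near [u] the norm is large since [r <= `|u|]; elsewhere the point is a
    definite multiple of [e] minus a multiple of [u]. *)
Lemma segment_off_line (c r : R) e u (t : R) : `|e| = 1 -> 0 <= c <= 1 / 2 ->
    off_line c e u -> 0 < r -> r <= `|u| -> 0 <= t <= 1 ->
  r * c / 4 <= `|u + t *: (r *: e - u)|.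
Proof.
move=> e1 /andP[c0 c2] ceu r0 ru /andP[t0 t1].
have [tq|tq] := leP t (1 / 4).
  have := lerB_dist u (- (t *: (r *: e - u))); rewrite opprK normrN normrZ.
  rewrite ger0_norm // => h; apply: le_trans h.
  have := ler_normB (r *: e) u; rewrite normrZ e1 mulr1 (gtr0_norm r0) => h.
  have : t * `|r *: e - u| <= t * (r + `|u|) by exact: ler_wpM2l.
  nra.
have -> : u + t *: (r *: e - u) = (t * r) *: (e - (- ((1 - t) / (t * r))) *: u).
  rewrite scaleNr opprK [RHS]scalerDr [X in _ = _ + X]scalerA [t * r * _]mulrC divfK; last first.
    by rewrite mulf_neq0 ?gt_eqF //; lra.
  by rewrite scalerBr scalerBl scale1r scalerA addrCA.
have tr : 0 < t * r by rewrite mulr_gt0 //; lra.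
rewrite normrZ (gtr0_norm tr).
apply: (@le_trans _ _ (t * r * c)); last by rewrite ler_pM2l.
by have := mulr_ge0 (ltW r0) c0; nra.
Qed.

End Plane.

(** * From the cross-ratio condition to cigars *)

Section DeltaUniform.
Variables (R : realType) (E : normedModType R) (G : set E).
Hypotheses (GT : G <> setT) (oG : open G).
Local Notation d := (cdist G).

Lemma segment_linked (S : set E) x y :
    (forall t, 0 <= t <= 1 -> 0 < d (x + t *: (y - x)) /\ S (x + t *: (y - x))) ->
  linked G S x y.
Proof.
move=> h; have [||n [tau [t0 tn _ ti tc]]] :=
    @curve_gchain R E G GT oG (fun t => x + t *: (y - x)).
- apply: continuous_subspaceT => t.
  by apply: cvgD; [exact: cvg_cst|apply: cvgZr_tmp; exact: cvg_id].
- by move=> t /h[+ _]; exact: cdist_gt0_in.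
- exists n, (fun k => x + tau k *: (y - x)); split => //.
  + by rewrite t0 scale0r addr0.
  + by rewrite tn scale1r subrKC.
  + by move=> k /ti /h[].
Qed.

(** Going around a ball that contains the complement: from each point one
    moves straight to one of the two hubs [ctr + r *: e1], [ctr + r *: e2],
    whichever direction is off the line, and the hubs are joined by a segment
    as well. *)
Lemma annulus_linked (e1 e2 : E) (c : R) :
    `|e1| = 1 -> `|e2| = 1 -> 0 < c -> c <= 1 / 2 ->
    (forall u, off_line c e1 u \/ off_line c e2 u) ->
  forall (ctr : E) (b r M : R), (forall y, ~ G y -> `|ctr - y| <= b) ->
    0 < r -> b < r * c / 4 ->
  forall z1 z2, r <= `|z1 - ctr| <= M -> r <= `|z2 - ctr| <= M ->
  linked G [set z | `|z - ctr| <= M /\ r * c / 4 - b <= d z] z1 z2.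
Proof.
move=> n1 n2 c0 c2 dich ctr b r M Gb r0 br z1 z2 z1b z2b.
set S := [set z | _].
have c02 : 0 <= c <= 1 / 2 by rewrite c2 ltW.
have spoke e z : `|e| = 1 -> off_line c e (z - ctr) -> r <= `|z - ctr| <= M ->
    linked G S z (ctr + r *: e).
  move=> ne ez /andP[rz zM]; apply: segment_linked => t t01.
  set w := z + _.
  have wE : w - ctr = (z - ctr) + t *: (r *: e - (z - ctr)).
    by rewrite /w addrAC opprB [ctr + _]addrC addrA addrAC -addrA.
  have low := segment_off_line ne c02 ez r0 rz t01; rewrite -wE in low.
  have dw : r * c / 4 - b <= d w.
    apply: le_cdist => // y /Gb oy.
    by have := ler_distD y w ctr; rewrite (distrC y); lra.
  split; first by apply: lt_le_trans dw; lra.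
  split=> //.
  have -> : w - ctr = (1 - t) *: (z - ctr) + t *: (r *: e).
    by rewrite wE scalerBr scalerBl scale1r addrA addrAC.
  have /andP[t0 t1] := t01.
  apply: le_trans (ler_normD _ _) _; rewrite !normrZ ne mulr1 (gtr0_norm r0).
  by rewrite !ger0_norm ?subr_ge0 //; nra.
have rM : r <= M by case/andP: z1b => /le_trans; apply.
have hub e : `|e| = 1 -> r <= `|ctr + r *: e - ctr| <= M.
  by move=> ne; rewrite addrC addKr normrZ ne mulr1 gtr0_norm // lexx.
(* The hub in direction [e] lies on the line of [e], so the dichotomy selects
   the other direction there. *)
have self e : `|e| = 1 -> ~ off_line c e (ctr + r *: e - ctr).
  move=> ne /(_ r^-1); rewrite [ctr + _]addrC addrK scalerA mulVf ?gt_eqF //.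
  by rewrite scale1r subrr normr0; lra.
have hubs : linked G S (ctr + r *: e1) (ctr + r *: e2).
  apply: spoke => //; last exact: hub.
  by case: (dich (ctr + r *: e1 - ctr)) => // /(self _ n1).
case: (dich (z1 - ctr)) => h1; case: (dich (z2 - ctr)) => h2.
- exact: linked_trans (spoke _ _ n1 h1 z1b) (linked_sym (spoke _ _ n1 h2 z2b)).
- apply: linked_trans (spoke _ _ n1 h1 z1b) _.
  exact: linked_trans hubs (linked_sym (spoke _ _ n2 h2 z2b)).
- apply: linked_trans (spoke _ _ n2 h1 z1b) _.
  exact: linked_trans (linked_sym hubs) (linked_sym (spoke _ _ n1 h2 z2b)).
- exact: linked_trans (spoke _ _ n2 h1 z1b) (linked_sym (spoke _ _ n2 h2 z2b)).
Qed.

Variable delta : R.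
Hypotheses (delta0 : 0 < delta) (delta1 : delta < 1).
Hypothesis deltaG : delta_uniform_domain delta G.

Let C : R := 1 + 2 / delta.

(** The cross-ratio condition with denominators cleared, which also makes
    sense at the endpoints. *)
Lemma delta_linked x1 x2 : G x1 -> G x2 ->
  linked G [set z | forall y, ~ G y ->
    delta * (`|z - x1| * `|x2 - y|) <= `|z - y| * `|x1 - x2| /\
    delta * (`|z - x2| * `|x1 - y|) <= `|z - y| * `|x1 - x2|] x1 x2.
Proof.
move=> G1 G2; have [x12|x12] := eqVneq x1 x2.
  exists 0%N, (fun=> x1); split=> //.
  by move=> k _ y _; rewrite -x12 subrr normr0 !mul0r !mulr0.
have [g [[[gc gG] _] [g0 g1] gd]] := deltaG G1 G2 x12.
have [|n [tau [t0 tn _ ti tc]]] := curve_gchain GT oG gc.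
  by move=> t t01; apply: gG; exists t => //=; rewrite in_itv.
exists n, (g \o tau); split => //=; rewrite ?t0 ?tn // => k kn y Gy.
set z := g (tau k).
have pos (u v : E) : u != v -> 0 < `|u - v| by rewrite normr_gt0 subr_eq0.
have Gne w : G w -> w != y.
  by move=> Gw; apply/negP => /eqP e; apply: Gy; rewrite -e.
have q1 := pos _ _ (Gne _ G1); have q2 := pos _ _ (Gne _ G2).
have small (a : R) : 0 <= a -> delta * a <= a.
  by move=> a0; rewrite ler_piMl // ltW.
have [->|zx1] := eqVneq z x1.
  rewrite subrr normr0 mul0r mulr0 mulr_ge0 // (mulrC `|x1 - y|).
  by split=> //; apply: small; rewrite mulr_ge0.
have [->|zx2] := eqVneq z x2.
  rewrite subrr normr0 mul0r mulr0 mulr_ge0 // (distrC x2 x1) mulrC.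
  by split=> //; rewrite mulrC [leRHS]mulrC; apply: small; rewrite mulr_ge0.
have zim : (g @` `[0, 1]) z by exists (tau k) => //=; rewrite in_itv /= ti.
have [h1 h2] := gd z y zim zx1 zx2 Gy.
have p1 := pos _ _ zx1; have p2 := pos _ _ zx2.
have ratio (u v a e : R) : 0 < u -> 0 < v -> delta <= a / u * (e / v) ->
    delta * (u * v) <= a * e.
  by move=> u0 v0; rewrite mulrACA -invfM ler_pdivlMr // mulr_gt0.
by split; [exact: ratio h1|rewrite (distrC x1 x2); exact: ratio h2].
Qed.

(** If [x1] is the nearer endpoint, then [`|z - x2|] is at least half of
    [`|x1 - x2|], and the second inequality bounds [`|x1 - y|], hence
    [`|z - x1|], by a multiple of [`|z - y|]. *)
Lemma delta_distance_cigar x1 x2 z :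
    (forall y, ~ G y ->
      delta * (`|z - x1| * `|x2 - y|) <= `|z - y| * `|x1 - x2| /\
      delta * (`|z - x2| * `|x1 - y|) <= `|z - y| * `|x1 - x2|) ->
    x1 != x2 ->
  Num.min `|z - x1| `|z - x2| <= C * d z.
Proof.
move=> h x12; have C0 : 0 < C by rewrite /C addr_gt0 // divr_gt0.
rewrite mulrC -ler_pdivrMr //; apply: le_cdist => // y Gy.
rewrite ler_pdivrMr // mulrC /C.
have r0 : 0 < `|x1 - x2| by rewrite normr_gt0 subr_eq0.
have one u v : `|z - u| <= `|z - v| -> `|u - v| = `|x1 - x2| ->
    delta * (`|z - v| * `|u - y|) <= `|z - y| * `|x1 - x2| ->
    `|z - u| <= (1 + 2 / delta) * `|z - y|.
  move=> uv uvr hd; have hv : `|x1 - x2| <= 2 * `|z - v|.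
    by have := ler_distD z u v; rewrite (distrC u z); lra.
  have huy : `|u - y| <= 2 / delta * `|z - y|.
    rewrite mulrAC ler_pdivlMr // mulrC -(ler_pM2r r0).
    have : delta * `|u - y| * `|x1 - x2| <= delta * `|u - y| * (2 * `|z - v|).
      by rewrite ler_wpM2l // mulr_ge0 // ltW.
    lra.
  by have := ler_distD y z u; rewrite (distrC y u); lra.
have [h1 h2] := h y Gy.
case: (leP `|z - x1| `|z - x2|) => hz; first exact: (one _ x2).
by apply: (one _ x1) => //; [exact: ltW|rewrite distrC].
Qed.

Lemma delta_distance_linked x1 x2 : G x1 -> G x2 ->
  linked G [set z | Num.min `|z - x1| `|z - x2| <= C * d z] x1 x2.
Proof.
move=> G1 G2; have [<-|x12] := eqVneq x1 x2.
  exists 0%N, (fun=> x1); split=> //.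
  move=> k _ /=; rewrite minxx subrr normr0 mulr_ge0 ?cdist_ge0 //.
  by rewrite /C addr_ge0 // divr_ge0 // ltW.
have [n [p [cp p0 pn pS]]] := delta_linked G1 G2.
by exists n, p; split=> // k kn; apply: delta_distance_cigar => //; exact: pS.
Qed.

(** Let [q] be on the arc.  The distances from [y0] to [z1] and [z2] are large
    compared with [`|z1 - z2|], so the cross-ratio condition at [y0] makes
    [`|q - z1|] at most half of [`|q - y0|], hence at most a multiple of
    [`|z1 - y0|].  Then so is [`|q - y0|], and the same condition bounds
    [`|q - z1|] by a multiple of [r]. *)
Lemma delta_link_near x1 z1 z2 y0 (r rho : R) : G z1 -> G z2 -> ~ G y0 ->
    0 < r -> 12 / delta * r < `|x1 - y0| ->
    `|z1 - x1| <= r -> `|z2 - x1| <= 2 * r ->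
    rho <= d z1 -> rho <= d z2 ->
  linked G [set z | `|z - x1| <= (24 / delta + 1) * r /\ rho <= (C + 1) * d z]
    z1 z2.
Proof.
move=> G1 G2 Gy r0 y0far z1x z2x d1 d2.
have C0 : 0 <= C by rewrite /C addr_ge0 // divr_ge0 // ltW.
have [z12|z12] := eqVneq z1 z2.
  exists 0%N, (fun=> z1); split=> //.
  move=> k _; split; first by rewrite mulrDl mul1r ler_wpDl // mulr_ge0 ?divr_ge0 // ltW.
  by apply: le_trans d1 _; rewrite ler_peMl ?cdist_ge0 // lerDr.
have [n [p [cp p0 pn pS]]] := delta_linked G1 G2.
exists n, p; split=> // k kn; set q := p k.
have qd := pS k kn; rewrite -/q in qd; split.
  have [h _] := qd y0 Gy.
  have t1 := ler_distD x1 z1 z2; rewrite (distrC x1 z2) in t1.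
  have t2 := ler_distD z2 x1 y0; rewrite (distrC x1 z2) in t2.
  have t3 := ler_distD z1 q y0; have t4 := ler_distD x1 z1 y0.
  have t5 := ler_distD z1 q x1.
  set D := `|x1 - y0| in y0far t2 t4; set a := `|q - z1| in h t3 t5.
  have a0 : 0 <= a by exact: normr_ge0.
  have hD : 12 * r < delta * D by move: y0far; rewrite mulrAC ltr_pdivrMr //; lra.
  have D12 : 12 * r < D.
    by apply: lt_le_trans hD _; rewrite ler_piMl ?normr_ge0 // ltW.
  have D0 : 0 < D by lra.
  have up : `|q - y0| * `|z1 - z2| <= (a + 2 * D) * (3 * r).
    by apply: ler_pM => //; lra.
  (* [`|z2 - y0|] is at least half of [D], since [D] exceeds 12 r. *)
  have lo : delta * (a * (D / 2)) <= delta * (a * `|z2 - y0|).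
    by rewrite ler_pM2l // ler_wpM2l //; lra.
  have aD : a * (12 * r) <= a * (delta * D) by rewrite ler_wpM2l // ltW.
  have : delta * a * D <= 24 * r * D by lra.
  rewrite ler_pM2r // mulrC -ler_pdivlMr // => ha.
  have -> : (24 / delta + 1) * r = 24 * r / delta + r by lra.
  by lra.
have := delta_distance_cigar qd z12; rewrite ge_min => /orP[h|h].
  by have := cdist_lip GT z1 q; rewrite distrC; lra.
by have := cdist_lip GT z2 q; rewrite distrC; lra.
Qed.

(** Climb from both endpoints and link the ends.  When the complement lies
    within [b * r] of [x1] there may be no link at scale [r]; one climbs
    towards points at distance [T * r] instead, with [T] so large that the
    climb leaves the ball containing the complement. *)
Lemma delta_cigar : dim_ge2 E -> exists2 A, 1 <= A & cigar_domain G A.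
Proof.
move=> /two_directions[e1 [e2 [c [n1 n2 c0 c2 dich]]]].
have id0 : 1 < delta^-1 by rewrite invf_gt1.
have C3 : 3 <= C by rewrite /C; lra.
have C1 : 1 <= C by lra.
pose K := 8 * C * (C + 1).
pose b := 12 / delta; pose T := 12 * C * (8 * b / c + b).
pose A := (24 / delta + 1) + 12 * C * (C + 1) + 2 * T.
have b12 : 12 <= b by rewrite /b; lra.
have bc0 : 0 < 8 * b / c by rewrite divr_gt0 //; lra.
have T36 : 36 * (8 * b / c + b) <= T.
  by rewrite /T ler_pM2r //; lra.
have T1 : 36 <= T by lra.
have cl x w := climb GT oG C1 delta_distance_linked (x := x) (w := w).
have C24 : 24 <= 8 * C * (C + 1) by nra.
have K0 : 0 <= K by rewrite /K; lra.
have dA : 0 <= 24 / delta by rewrite divr_ge0 // ltW.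
have dA' : 0 <= 12 * C * (C + 1) by rewrite !mulr_ge0 //; lra.
have A3 : 24 / delta + 1 <= A by rewrite /A; lra.
have A2 : 12 * C * (C + 1) <= A by rewrite /A; lra.
have A4 : 2 * T <= A by rewrite /A; lra.
have A1 : 1 <= A by lra.
have AK0 : 0 <= A by lra.
exists (4 * (K + A * A) + 2 * (A + 1) + 1).
  by have := mulr_ge0 AK0 AK0; lra.
move=> x1 x2 G1 G2 x12.
apply: cigar_arc_of_chain => //.
- lra.
- by have := mulr_ge0 AK0 AK0; lra.
move=> _; set r := `|x1 - x2|.
have r0 : 0 < r by rewrite normr_gt0 subr_eq0.
have widen M x z : M <= A -> climbing G K (M * r) x z -> climbing G K (A * r) x z.
  move=> MA [n [p [cp p0 pn pM pK]]]; exists n, p; split=> // i /pM h.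
  by apply: le_trans h _; rewrite ler_wpM2r // ltW.
have widenS S z1 z2 : S `<=` [set z | `|z - x1| <= A * r /\ r <= A * d z] ->
    linked G S z1 z2 ->
    linked G [set z | `|z - x1| <= A * r /\ r <= A * d z] z1 z2.
  by move=> SS [n [p [cp p0 pn pS]]]; exists n, p; split=> // k /pS /SS.
have [[y0 Gy0 y0far]|near] := pselect (exists2 y0, ~ G y0 & b * r < `|x1 - y0|).
  have [z1 [cz1 dz1]] := cl x1 x2 G1 G2 x12.
  have x21 : x2 != x1 by rewrite eq_sym.
  have [z2 [cz2 dz2]] := cl x2 x1 G2 G1 x21.
  rewrite (distrC x2 x1) in cz2 dz2; rewrite -/r -/K in cz1 cz2 dz1 dz2.
  have cin x z : climbing G K r x z -> `|z - x| <= r /\ G z.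
    by case=> n [p [[Gp _] _ <- pM _]]; split; [exact: pM|exact: Gp].
  have [z1r Gz1] := cin _ _ cz1; have [z2r Gz2] := cin _ _ cz2.
  rewrite -[r]mul1r in cz1 cz2.
  apply: join_climbing => //.
  - by apply: widen cz1; lra.
  - by apply: widen cz2; lra.
  apply: widenS (@delta_link_near x1 z1 z2 y0 r (r / (12 * C)) _ _ _ _ _ _ _ _ _) => //.
  - move=> z [zx1 zd]; split; first by apply: le_trans zx1 _; rewrite ler_wpM2r ?(ltW r0) //; lra.
    move: zd; rewrite ler_pdivrMr; last by lra.
    have dz : 0 <= d z by exact: cdist_ge0.
    have : 12 * C * (C + 1) * d z <= A * d z by rewrite ler_wpM2r //; lra.
    by lra.
  - by have := ler_distD x2 z2 x1; rewrite (distrC x2 x1) -/r; lra.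
  - by rewrite ler_pdivrMr; [lra|lra].
  - by rewrite ler_pdivrMr; [lra|lra].
have Gb y : ~ G y -> `|x1 - y| <= b * r.
  by move=> Gy; rewrite leNgt; apply/negP => h; apply: near; exists y.
(* The link around the ball keeps a distance [R0 * c / 4] from [x1], twice
   the radius [b * r] of the ball. *)
pose R0 := 8 * b / c * r.
have R00 : 0 < R0 by rewrite mulr_gt0.
have reach x : G x -> `|x - x1| <= r -> exists z,
    climbing G K (T * r) x z /\ R0 <= `|z - x1| <= 2 * T * r.
  move=> Gx xx1; pose w := x + (T * r) *: e1.
  have Tr : 0 < T * r by rewrite mulr_gt0 //; lra.
  have xw : `|x - w| = T * r.
    by rewrite /w opprD addNKr normrN normrZ n1 mulr1 gtr0_norm.
  have Gw : G w.
    apply: contrapT => /Gb; have := ler_distD x1 x w.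
    have : 36 * (8 * b / c + b) * r <= T * r by rewrite ler_wpM2r // ltW.
    have : 0 <= 8 * b / c * r by rewrite mulr_ge0 // ltW.
    have : 12 * r <= b * r by rewrite ler_wpM2r // ltW.
    by rewrite xw; lra.
  have xwN : x != w by rewrite -subr_eq0 -normr_eq0 xw gt_eqF.
  have [z [cz dz]] := cl x w Gx Gw xwN; rewrite xw -/K in cz dz.
  exists z; split=> //.
  have zx : `|z - x| <= T * r by case: cz => n [p [_ _ <- pM _]]; exact: pM.
  apply/andP; split; last first.
    have := ler_distD x z x1.
    have : 36 * r <= T * r by rewrite ler_wpM2r // ltW.
    by lra.
  have [y0 Gy0] := compl_nonempty GT.
  have h1 := cdist_le z Gy0; have h2 := Gb y0 Gy0; have h3 := ler_distD x1 z y0.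
  move: dz; rewrite /T -[_ * _ * r]mulrA ler_pM2l; last by lra.
  by rewrite /R0; lra.
have [z1 [cz1 z1R]] := reach x1 G1 ltac:(by rewrite subrr normr0 ltW).
have [z2 [cz2 z2R]] := reach x2 G2 ltac:(by rewrite distrC).
have RcE : R0 * c / 4 = 2 * (b * r).
  by rewrite /R0; field; rewrite gt_eqF.
apply: join_climbing => //.
- by apply: widen cz1; lra.
- by apply: widen cz2; lra.
have br : 12 * r <= b * r by rewrite ler_wpM2r // ltW.
apply: widenS (annulus_linked n1 n2 c0 c2 dich Gb R00 _ z1R z2R).
  move=> z [zx1 zd]; split.
    by apply: le_trans zx1 _; rewrite ler_wpM2r ?(ltW r0) //; lra.
  have dz : r <= d z by rewrite RcE in zd; lra.
  by apply: le_trans dz _; rewrite ler_peMl // cdist_ge0.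
by rewrite RcE; lra.
Qed.

End DeltaUniform.

(** * Comparison of the four notions *)

Theorem theorem1p1 (R : realType) (E : completeNormedModType R)
    (hE : dim_ge2 E) (G : set E) (hG : is_domain G) (hGE : G <> [set: E]) :
  [/\ forall c : R, 1 <= c -> uniform_domain c G -> min_max_property G,
      min_max_property G ->
        exists c1 : R, 1 <= c1 /\ diam_uniform_domain c1 G
    & (exists c1 : R, 1 <= c1 /\ diam_uniform_domain c1 G) <->
      (exists delta : R, [/\ 0 < delta, delta < 1 &
                             delta_uniform_domain delta G])].
Proof.
have oG : open G by case: hG.
split.
- by move=> c c1 /(uniform_cigar hGE oG); exact: cigar_min_max.
- case/(min_max_cigar hGE oG) => C C1 /(cigar_diam_uniform hGE oG) CG.
  by exists (2 * C); split=> //; lra.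
- split=> [[c [c1 /(diam_uniform_cigar hGE oG) cG]]|[delta [delta0 delta1 dG]]].
    exists ((c + 1) * (c + 2))^-1; split.
    + by rewrite invr_gt0 mulr_gt0 //; lra.
    + by rewrite invf_lt1; nra.
    + exact: cigar_delta_uniform.
  have [C C1 CG] := delta_cigar hGE oG delta0 delta1 dG hE.
  exists (2 * C); split; first by lra.
  exact: cigar_diam_uniform.
Qed.
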